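(* Let $d\in\{1,2,3\}$, let $\Omega\subset\mathbb{R}^d$ be a bounded domain and let $T>0$. There is an integer $m$ such that the following holds (''sufficiently smooth'' means of class $C^m$ up to the boundary). Let $u:\overline\Omega\times[0,T]\to\mathbb{R}^d$ be sufficiently smooth with $u=0$ on $\partial\Omega\times[0,T]$, and let $\zeta:\overline\Omega\times[0,T]\to\mathbb{R}^{d\times d}$ be sufficiently smooth. Then there is a constant $C>0$, independent of $\Delta t$, $x$ and $n$, such that for every $\Delta t>0$ with $\Delta t\,|u|_{C^0([0,T];W^{1,\infty}(\Omega)^d)}\le 1/8$, every $x\in\overline\Omega$ and every $n\in\{2,\ldots,N_T\}$, $$\Bigl|\overset{\nabla}{\zeta}(x,t^n)-\frac{1}{2\Delta t}\Bigl[3\zeta^n(x)-4L_1^n(x)\,\bigl(\zeta^{n-1}\circ X_1^n\bigr)(x)\,L_1^n(x)^\top+\tilde L_1^n(x)\,\bigl(\zeta^{n-2}\circ\tilde X_1^n\bigr)(x)\,\tilde L_1^n(x)^\top\Bigr]\Bigr|\le C\,\Delta t^2 .$$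
   Context: Notation: $t^n=n\Delta t$, $N_T=\lfloor T/\Delta t\rfloor$, $f^n=f(\cdot,t^n)$; $(\nabla u)_{ij}=\partial u_i/\partial x_j$; $I$ is the $d\times d$ identity matrix; $|\cdot|$ is the Euclidean norm (Frobenius norm for matrices); $|u|_{C^0([0,T];W^{1,\infty}(\Omega)^d)}=\max_{t\in[0,T]}\operatorname{ess\,sup}_{x\in\Omega}|\nabla u(x,t)|$. Further, $X_1^n(x)=x-\Delta t\,u^n(x)$, $\tilde X_1^n(x)=x-2\Delta t\,u^n(x)$, $L_1^n(x)=I+\Delta t\,(\nabla u^n)(x)$, $\tilde L_1^n(x)=I+2\Delta t\,(\nabla u^n)(x)$. The upper-convected time derivative of $\zeta$ is $$\overset{\nabla}{\zeta}=\frac{\partial\zeta}{\partial t}+(u\cdot\nabla)\zeta-(\nabla u)\zeta-\zeta(\nabla u)^\top .$$ A function on $\overline\Omega\times[0,T]$ is of class $C^m$ up to the boundary if all its partial derivatives of order at most $m$ in $\Omega\times(0,T)$ exist and extend continuously to $\overline\Omega\times[0,T]$; derivatives at boundary points mean these extensions. The conditions on $u$ and $\Delta t$ ensure $X_1^n(x),\tilde X_1^n(x)\in\overline\Omega$ for $x\in\overline\Omega$. *)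

(* Defs.v *)
From mathcomp Require Export all_boot all_order all_algebra.
From mathcomp Require Export all_classical all_reals all_analysis.

Set Implicit Arguments.
Unset Strict Implicit.
Unset Printing Implicit Defensive.

Import Order.TTheory GRing.Theory Num.Theory.
Import numFieldNormedType.Exports.

Local Open Scope classical_set_scope.
Local Open Scope ring_scope.

(* The library norm on matrices is the sup norm; only the topology it induces
   and the boundedness of sets are taken from it. *)
Definition frobenius {R : realType} {m n : nat} (A : 'M[R]_(m, n)) : R :=
  Num.sqrt (\sum_i \sum_j A i j ^+ 2).

Definition bounded_domain {R : realType} {d : nat} (Omega : set 'cV[R]_d) :=
  [/\ open Omega, connected Omega, Omega !=set0 & bounded_set Omega].

Definition boundary {T : topologicalType} (A : set T) : set T :=
  closure A `\` interior A.

(** Lebesgue outer measure on R^d and the essential supremum. *)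
Section EssentialSupremum.
Context {R : realType} {d : nat}.

Definition box (a b : 'cV[R]_d) : set 'cV[R]_d :=
  [set x | forall i, a i 0 <= x i 0 <= b i 0].

Definition box_volume (a b : 'cV[R]_d) : R := \prod_i (b i 0 - a i 0).

Definition lebesgue_outer (A : set 'cV[R]_d) : \bar R :=
  ereal_inf [set s | exists a b : nat -> 'cV[R]_d,
    [/\ forall k i, a k i 0 <= b k i 0,
        A `<=` \bigcup_k box (a k) (b k) &
        s = (\sum_(0 <= k <oo) (box_volume (a k) (b k))%:E)%E]].

(* The library's [ess_sup] needs a measure on a measurable type, and the library
   has no Lebesgue measure on R^d for general d. *)
Definition ess_sup_on (A : set 'cV[R]_d) (f : 'cV[R]_d -> R) : \bar R :=
  ereal_inf [set y : \bar R |
    lebesgue_outer (A `&` [set x | (y < (f x)%:E)%E]) = 0%E].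

End EssentialSupremum.

(* Functions on (closure Omega) x [0, T] are total functions of the pair (x, t)
   whose values off that set are irrelevant. *)
Section SpaceTime.
Context {R : realType} {d : nat}.
Variables (Omega : set 'cV[R]_d) (T : R).

Definition cylinder : set ('cV[R]_d * R) := Omega `*` `]0, T[.
Definition closed_cylinder : set ('cV[R]_d * R) := closure Omega `*` `[0, T].

(* [Some i] is the i-th space direction, [None] is the time direction. *)
Definition dir (i : option 'I_d) : 'cV[R]_d * R :=
  if i is Some j then (delta_mx j 0, 0) else (0, 1).

Definition pderiv {W : normedModType R} (s : seq (option 'I_d))
    (f : 'cV[R]_d * R -> W) : 'cV[R]_d * R -> W :=
  foldr (fun i g => 'D_(dir i) g) f s.

(* The first clause is the case s = [::] of the last one, with the extension
   required to be f itself. *)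
Definition C_upto_boundary {W : normedModType R} (m : nat)
    (f : 'cV[R]_d * R -> W) : Prop :=
  [/\ {within closed_cylinder, continuous f},
      forall (s : seq (option 'I_d)) i p, (size s < m)%N -> cylinder p ->
        derivable (pderiv s f) p (dir i) &
      forall s : seq (option 'I_d), (size s <= m)%N ->
        exists g : 'cV[R]_d * R -> W,
          {within closed_cylinder, continuous g} /\
          forall p, cylinder p -> g p = pderiv s f p].

(* First partial derivative on the closed cylinder: the limit taken from inside
   the open cylinder is the value of the continuous extension. *)
Definition partial {W : normedModType R} (i : option 'I_d)
    (f : 'cV[R]_d * R -> W) (p : 'cV[R]_d * R) : W :=
  lim ('D_(dir i) f @ within cylinder (nbhs p)).

Definition grad (u : 'cV[R]_d * R -> 'cV[R]_d) (p : 'cV[R]_d * R) : 'M[R]_d :=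
  \matrix_(i, j) (partial (Some j) u p) i 0.

(* Extended-real valued, so that an infinite norm is not collapsed to 0. *)
Definition C0W1inf_norm (u : 'cV[R]_d * R -> 'cV[R]_d) : \bar R :=
  ereal_sup [set ess_sup_on Omega (fun x => frobenius (grad u (x, t)))
            | t in `[0, T]].

Definition upper_convected (u : 'cV[R]_d * R -> 'cV[R]_d)
    (zeta : 'cV[R]_d * R -> 'M[R]_d) (p : 'cV[R]_d * R) : 'M[R]_d :=
  partial None zeta p + \sum_j (u p) j 0 *: partial (Some j) zeta p
  - grad u p *m zeta p - zeta p *m (grad u p)^T.

Definition tn (dt : R) (n : nat) : R := n%:R * dt.

Definition X1 (u : 'cV[R]_d * R -> 'cV[R]_d) (dt : R) (n : nat) (x : 'cV[R]_d) :=
  x - dt *: u (x, tn dt n).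
Definition X1t (u : 'cV[R]_d * R -> 'cV[R]_d) (dt : R) (n : nat) (x : 'cV[R]_d) :=
  x - (2 * dt) *: u (x, tn dt n).

Definition L1 (u : 'cV[R]_d * R -> 'cV[R]_d) (dt : R) (n : nat) (x : 'cV[R]_d)
  : 'M[R]_d := 1%:M + dt *: grad u (x, tn dt n).
Definition L1t (u : 'cV[R]_d * R -> 'cV[R]_d) (dt : R) (n : nat) (x : 'cV[R]_d)
  : 'M[R]_d := 1%:M + (2 * dt) *: grad u (x, tn dt n).

Definition bdf2_upper_convected (u : 'cV[R]_d * R -> 'cV[R]_d)
    (zeta : 'cV[R]_d * R -> 'M[R]_d) (dt : R) (n : nat) (x : 'cV[R]_d) : 'M[R]_d :=
  (2 * dt)^-1 *:
    (3 *: zeta (x, tn dt n)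
     - 4 *: (L1 u dt n x *m zeta (X1 u dt n x, tn dt (n - 1)%N) *m (L1 u dt n x)^T)
     + L1t u dt n x *m zeta (X1t u dt n x, tn dt (n - 2)%N) *m (L1t u dt n x)^T).

End SpaceTime.

(* Main.v *)
Require Import Defs.
From mathcomp Require Import ring lra.
Set Implicit Arguments.
Unset Strict Implicit.
Unset Printing Implicit Defensive.
Import Order.TTheory GRing.Theory Num.Theory.
Import numFieldNormedType.Exports.
Local Open Scope classical_set_scope.
Local Open Scope ring_scope.

(** Write [phi s = zeta (x - s u, t - s)] with [u = u (x, t)] frozen.  The
    upper-convected derivative at [(x, t)] is
    [- phi' 0 - (grad u) phi 0 - phi 0 (grad u)^T], and expanding the products
    with [L1] and [L1t] reduces the error of the scheme to the backward
    differences [phi (2h) - phi h], [phi 0 - 2 phi h + phi (2h)] and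
    [2h phi' 0 + 3 phi 0 - 4 phi h + phi (2h)] of respective orders 1, 2 and 3
    (lemma [bdf2_error_identity]).

    Taylor's formula needs the segment [x - s u], [0 <= s <= 2h], to lie in
    Omega, which is not assumed to have a regular boundary.  If the segment
    first leaves Omega at parameter [r <= 2h], then [u] vanishes at the exit
    point, so the mean value theorem along the segment gives
    [|u| <= 2h d sup |grad u| |u| <= 3/4 |u|], hence [u = 0] and the segment
    is the single point [x].  The pointwise bound on [grad u] follows from the
    essential supremum because nonempty open sets have positive outer measure.

    Points of the boundary of the cylinder are reached as limits of interior
    points, with a slightly smaller step. *)

(** * Lebesgue outer measure *)

(* The library has no Lebesgue measure on R^d: the volume of boxes is realized
   by an iterated product of one-dimensional Lebesgue measures. *)
Lemma box_volume_measure (R : realType) (d : nat) :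
  exists (disp : measure_display) (X : measurableType disp)
    (mu : {measure set X -> \bar R}) (phi : X -> 'cV[R]_d),
  forall a b : 'cV[R]_d, (forall i, a i 0 <= b i 0) ->
    measurable (phi @^-1` box a b) /\
    mu (phi @^-1` box a b) = (box_volume a b)%:E.
Proof.
elim: d => [|d [disp [X [mu [phi phiP]]]]].
  exists _, unit, (dirac tt), (fun=> 0) => a b _.
  rewrite (_ : _ @^-1` _ = setT); last first.
    by apply/seteqP; split=> // x _ [].
  by split; [exact: measurableT|rewrite /box_volume big_ord0; exact: diracT].
pose lam : {sigma_finite_measure set _ -> \bar R} := @lebesgue_measure R.
(* Coordinate [0] is read off the new real factor; [unlift] sends the remaining ones to the space
   given by induction. *)
exists _, (X * measurableTypeR R)%type, (mu \x lam)%E,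
  (fun p => \col_i oapp (fun j => phi p.1 j 0) p.2 (unlift ord0 i)) => a b ab.
pose a' : 'cV[R]_d := \col_i a (lift ord0 i) 0.
pose b' : 'cV[R]_d := \col_i b (lift ord0 i) 0.
have ab' i : a' i 0 <= b' i 0 by rewrite !mxE.
have [mA muA] := phiP a' b' ab'.
rewrite (_ : _ @^-1` _ = (phi @^-1` box a' b') `*` `[a 0 0, b 0 0]); last first.
  apply/seteqP; split=> -[x r] /=; rewrite /box /= in_itv /=.
    move=> H; split; last by have := H 0; rewrite mxE unlift_none.
    by move=> i; have := H (lift ord0 i); rewrite !mxE liftK.
  move=> [H1 H2] i; rewrite mxE.
  by case: unliftP => [j|] -> //=; have := H1 j; rewrite !mxE.
have mI : measurable (`[a 0 0, b 0 0]%classic : set (measurableTypeR R)).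
  exact: measurable_itv.
split; first exact: measurableX.
apply: (etrans (product_measure1E mu lam mA mI)).
rewrite muA /lam /= lebesgue_measure_itv /= lte_fin.
rewrite /box_volume big_ord_recl /=.
have -> : \prod_(i < d) (b' i 0 - a' i 0) =
   \prod_(i < d) (b (lift ord0 i) 0 - a (lift ord0 i) 0).
  by apply: eq_bigr => i _; rewrite !mxE.
case: ltP => [_|ba]; first by rewrite -EFinB -EFinM mulrC.
have -> : b ord0 0 = a ord0 0 by apply/eqP; rewrite eq_le ab ba.
by rewrite subrr mul0r mule0.
Qed.

(** A countable cover of [A] by boxes also covers [box a b], so sigma-subadditivity of the measure
    realizing volumes bounds its total volume below by that of [box a b], a product of positive side
    lengths. *)
Lemma lebesgue_outer_box_gt0 (R : realType) (d : nat) (A : set 'cV[R]_d)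
    (a b : 'cV[R]_d) :
  (forall i, a i 0 < b i 0) -> box a b `<=` A -> lebesgue_outer A != 0%E.
Proof.
move=> ab sA; have [disp [X [mu [phi phiP]]]] := box_volume_measure R d.
have le_ab i : a i 0 <= b i 0 by exact: ltW.
have [mB muB] := phiP a b le_ab.
suff : ((box_volume a b)%:E <= lebesgue_outer A)%E.
  move=> H; rewrite gt_eqF// (lt_le_trans _ H)// lte_fin.
  by apply: prodr_gt0 => i _; rewrite subr_gt0.
apply: le_ereal_inf_tmp => _ [a' [b' [ab' cov ->]]].
rewrite -muB.
apply: le_trans
  (measure_sigma_subadditive mu (fun k => proj1 (phiP _ _ (ab' k))) mB _) _.
  by move=> x /sA/cov [k _ ?]; exists k.
rewrite le_eqVlt; apply/orP; left; apply/eqP/eq_eseriesr => k _.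
by case: (phiP _ _ (ab' k)).
Qed.

(** A level [y] below [f x] with negligible superlevel set is impossible: by continuity [f] exceeds
    [y] on a whole box around [x] inside [A], and such a box is not negligible. *)
Lemma le_ess_sup_on (R : realType) (d : nat) (A : set 'cV[R]_d)
    (f : 'cV[R]_d -> R) (x : 'cV[R]_d) :
  open A -> A x -> {for x, continuous f} -> ((f x)%:E <= ess_sup_on A f)%E.
Proof.
move=> oA Ax fx; rewrite leNgt; apply/negP => /ereal_inf_lt [y /= y0 yf].
suff : \forall z \near x, A z /\ (y < (f z)%:E)%E.
  move=> /nbhs_ballP [e /= e0 xe]; move/eqP: y0; apply/negP.
  apply: (@lebesgue_outer_box_gt0 _ _ _ (x - const_mx (e / 2)) (x + const_mx (e / 2))).
    by move=> i; rewrite !mxE; lra.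
  move=> z zb; apply: xe; split => // i j; rewrite ord1.
  have := zb i; rewrite !mxE => /andP[h1 h2].
  by rewrite /ball /= ltr_distlC; apply/andP; split; lra.
near=> z; split; first by near: z; exact: open_nbhs_nbhs.
near: z; case: y yf {y0} => [y| |] //=.
- by rewrite lte_fin => yf; under eq_near do rewrite lte_fin; exact: (cvgr_gt (f x)).
- by move=> _; near=> z; rewrite ltNyr.
Unshelve. all: by end_near. Qed.

(** * Derivatives along lines *)

Lemma is_derive_entry (R : realType) (V : normedModType R) (m n : nat)
    (F : V -> 'M[R]_(m, n)) (L : 'M[R]_(m, n)) (p v : V) i j :
  is_derive p v F L -> is_derive p v (fun x => F x i j) (L i j).
Proof.
move=> [dF <-]; apply: DeriveDef; first by move/derivable_mxP: dF.
by rewrite derive_mx // mxE.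
Qed.

Lemma is_derive_line (R : realType) (V : normedModType R) (f : V -> R)
    (q v : V) (s df : R) :
  is_derive (q + s *: v) v f df -> is_derive s 1 (fun r => f (q + r *: v)) df.
Proof.
have E : (fun h => h^-1 *: ((f \o shift (q + s *: v)) (h *: v) - f (q + s *: v)))
   = (fun h : R => h^-1 *: (((fun r => f (q + r *: v)) \o shift s) (h *: 1)
                            - f (q + s *: v))).
  apply/funext => h /=; congr (_ *: (f _ - _)).
  by rewrite [h *: 1]mulr1 scalerDl addrCA.
by move=> [df1 df2]; apply: DeriveDef; move: df1 df2; rewrite /derivable /derive E.
Qed.

Lemma MVT_closed (R : realType) (f df : R -> R) (a b : R) :
  a <= b -> (forall x : R, x \in `[a, b] -> is_derive x 1 f (df x)) ->
  exists2 c, c \in `[a, b] & f b - f a = df c * (b - a).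
Proof.
move=> ab fd.
have fd2 (x : R) : x \in `]a, b[ -> is_derive x 1 f (df x).
  rewrite in_itv /= => /andP[ax xb].
  apply: fd.
  by rewrite in_itv /= !ltW.
have cf : {within `[a, b], continuous f}.
  apply: derivable_within_continuous => x xab.
  have fx := fd x xab.
  exact: ex_derive.
exact: (@MVT_segment _ f df a b ab fd2 cf).
Qed.

(** Increments of either sign occur when a directional derivative is split, so the intermediate
    point is located by its distance to [a]. *)
Lemma MVT_unordered (R : realType) (f df : R -> R) (a b : R) :
  (forall x, `|x - a| <= `|b - a| -> is_derive x 1 f (df x)) ->
  exists2 c, `|c - a| <= `|b - a| & f b - f a = df c * (b - a).
Proof.
case: (leP a b) => ab fd.
  have [|c cab ->] := @MVT_closed _ f df _ _ ab.
    move=> x; rewrite in_itv /= => /andP[ax xb]; apply: fd.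
    by rewrite !ger0_norm ?subr_ge0 // lerB.
  exists c => //; move: cab; rewrite in_itv /= => /andP[ac cb].
  by rewrite !ger0_norm ?subr_ge0 // lerB.
have [|c cab E] := @MVT_closed _ f df _ _ (ltW ab).
  move=> x; rewrite in_itv /= => /andP[bx xa]; apply: fd.
  by rewrite !ler0_norm ?subr_le0 ?(ltW ab) // lerN2 lerB.
exists c; last by rewrite -opprB E -mulrN opprB.
move: cab; rewrite in_itv /= => /andP[bc ca].
by rewrite !ler0_norm ?subr_le0 ?(ltW ab) // lerN2 lerB.
Qed.

(** Directional derivatives are not additive in the direction in general. Here continuity at [p] of
    the derivative along [w] gives additivity: the mean value theorem turns the increment along [w]
    into [h * c] times a value of [Dw] near [p]. *)
Lemma is_derive_addl (R : realType) (V : normedModType R) (f Dw : V -> R)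
    (p v w : V) (c df : R) :
  is_derive p v f df -> (\forall q \near p, is_derive q w f (Dw q)) ->
  {for p, continuous Dw} -> is_derive p (c *: w + v) f (c * Dw p + df).
Proof.
move=> [dv dvE] dw cw.
suff H : h^-1 *: ((f \o shift p) (h *: (c *: w + v)) - f p) @[h --> 0^']
    --> c * Dw p + df.
  by apply: DeriveDef; [apply: cvgP H|apply: cvg_lim H].
(* The displacement [h *: (c *: w + v)] is made in two moves, first [h *: v], then
   [(h * c) *: w]. *)
have -> : (fun h => h^-1 *: ((f \o shift p) (h *: (c *: w + v)) - f p)) =
    (fun h => h^-1 * (f (h *: v + p + (h * c) *: w) - f (h *: v + p))) \+
    (fun h => h^-1 *: ((f \o shift p) (h *: v) - f p)).
  apply/funext => h /=; rewrite -[_ * _]/(_ *: _) -scalerDr subrKA.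
  by congr (_ *: (f _ - _)); rewrite scalerDr scalerA -addrA addrC.
apply: cvgD; last by rewrite -dvE.
apply/cvgrPdist_le => e e0.
(* The tolerance is divided by [|c| + 1] to absorb the factor [c], which may be zero. *)
have e1 : 0 < e / (`|c| + 1) by rewrite divr_gt0 // ltr_wpDl.
have : \forall q \near p, is_derive q w f (Dw q) /\ `|Dw p - Dw q| <= e / (`|c| + 1).
  by near=> q; split; near: q => //; move/cvgrPdist_le : cw; apply.
move=> /nbhs_normP [r /= r0 rP].
(* Every point [h *: v + p + s *: w] with [|s| <= |h * c|] is within [|h| * (|v| + |c| * |w|)] of
   [p]; this decides how small [h] must be. *)
have M0 : 0 < `|v| + `|c| * `|w| + 1.
  by rewrite ltr_wpDl // addr_ge0 // mulr_ge0.
near=> h.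
have h0 : h != 0 by near: h; exact: nbhs_dnbhs_neq.
have hr : `|h| < r / (`|v| + `|c| * `|w| + 1).
  by near: h; apply: dnbhs0_lt; rewrite divr_gt0.
have inr s : `|s - 0| <= `|h * c - 0| ->
    is_derive (h *: v + p + s *: w) w f (Dw (h *: v + p + s *: w)) /\
    `|Dw p - Dw (h *: v + p + s *: w)| <= e / (`|c| + 1).
  rewrite !subr0 => sh; apply: rP; rewrite /= /ball_/=.
  rewrite -addrA addrCA opprD addrA subrr sub0r normrN.
  apply: le_lt_trans (ler_normD _ _) _; rewrite !normrZ.
  move: hr; rewrite ltr_pdivlMr // => hr; apply: le_lt_trans hr.
  rewrite normrM in sh; rewrite mulrDr mulr1 mulrDr -addrA lerD2l.
  by rewrite -[leLHS]addr0 lerD // mulrA ler_wpM2r.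
have [s sh] := @MVT_unordered _ (fun s => f (h *: v + p + s *: w))
  (fun s => Dw (h *: v + p + s *: w)) 0 (h * c)
  (fun s sh => is_derive_line (proj1 (inr s sh))).
rewrite scale0r addr0 subr0 => ->.
rewrite mulrCA mulKf // mulrC -mulrBl normrM.
have [_ H] := inr _ sh.
apply: le_trans (ler_wpM2r _ H) _ => //.
rewrite mulrAC ler_pdivrMr ?ltr_wpDl // ler_pM2l // lerDl //.
Unshelve. all: by end_near. Qed.

Lemma is_derive_lin_comb (R : realType) (V : normedModType R) (I : finType)
    (e : I -> V) (f : V -> R) (D : I -> V -> R) (p : V) (c : I -> R) :
  (forall i, \forall q \near p, is_derive q (e i) f (D i q)) ->
  (forall i, {for p, continuous (D i)}) ->
  is_derive p (\sum_i c i *: e i) f (\sum_i c i * D i p).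
Proof.
move=> de cD; elim: (index_enum I) => [|i s IHs].
  by rewrite !big_nil; exact: is_derive0.
by rewrite !big_cons; exact: is_derive_addl.
Qed.

(** * The space-time cylinder *)

(** Continuity within [A] controls [f] only along filters that eventually stay in [A]; all limits at
    boundary points are taken in this form. *)
Lemma within_continuous_cvg (S W : topologicalType) (U : Type) (A : set S)
    (f : S -> W) (F : set_system U) (th : U -> S) (p : S) :
  Filter F -> {within A, continuous f} -> A p -> (\forall z \near F, A (th z)) ->
  th z @[z --> F] --> p -> f (th z) @[z --> F] --> f p.
Proof.
move=> FF /subspace_continuousP cf Ap FA thp.
suff H : th z @[z --> F] --> within A (nbhs p) by apply: cvg_comp H (cf _ Ap).
move=> B; rewrite /within /= => /thp; rewrite /nbhs /=.
by apply: filterS2 FA => z Az; apply.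
Qed.

(** * Norm bounds and compactness of the closed cylinder *)

Lemma mx_norm_ler (R : realType) (m n : nat) (M : 'M[R]_(m, n)) (r : R) :
  0 <= r -> (forall i j, `|M i j| <= r) -> `|M| <= r.
Proof.
move=> r0 Mr; rewrite [leLHS]/Num.Def.normr /= mx_normrE.
by apply: bigmax_le => // -[i j] _; exact: Mr.
Qed.

Lemma entry_ler_norm (R : realType) (m n : nat) (M : 'M[R]_(m, n)) i j :
  `|M i j| <= `|M|.
Proof.
rewrite [leRHS]/Num.Def.normr /= mx_normrE.
exact: (le_bigmax _ (fun ij => `|M ij.1 ij.2|) (i, j)).
Qed.

(** Heine-Borel for row vectors, carried over by transposition, which is continuous and preserves
    bounds on entries. *)
Lemma compact_colvec (R : realType) (d : nat) (A : set 'cV[R]_d) :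
  bounded_set A -> closed A -> compact A.
Proof.
move=> bA cA.
have tr_cont m n : continuous (@trmx R m n).
  move=> M B /= [P MP PB]; exists (fun i j => P j i) => [i j|N NP].
    by have := MP j i; rewrite mxE.
  by apply: PB => i j; have := NP j i; rewrite mxE.
rewrite (_ : A = trmx @` (trmx @^-1` A)); last first.
  apply/seteqP; split=> [x Ax|_ [x Ax <-]//].
  by exists x^T; rewrite /= trmxK.
apply: continuous_compact; first exact/continuous_subspaceT/tr_cont.
apply: bounded_closed_compact; last by apply: closed_comp => // x _; exact: tr_cont.
case: bA => M [Mr MA]; exists M; split=> // r Mr' x Ax.
apply: le_trans (MA _ Mr' _ Ax); apply: mx_norm_ler => // i j.
by have := entry_ler_norm x^T j i; rewrite mxE.
Qed.

Lemma bounded_closure (R : realType) (V : normedModType R) (A : set V) :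
  bounded_set A -> bounded_set (closure A).
Proof.
case=> M [Mr MA]; exists M; split=> // r rM x.
have cB : closed [set y : V | `|y| <= r].
  apply: (@closed_comp _ _ (fun y : V => `|y|) [set z | z <= r]).
    by move=> y _; exact: norm_continuous.
  exact: closed_le.
move=> cAx; apply: cB; move: x cAx; apply: closureS; exact: MA.
Qed.

Lemma closed_cylinder_compact (R : realType) (d : nat) (Omega : set 'cV[R]_d)
    (T : R) : bounded_set Omega -> compact (closed_cylinder Omega T).
Proof.
move=> bO; apply: compact_setX; last exact: segment_compact.
by apply: compact_colvec; [exact: bounded_closure|exact: closed_closure].
Qed.

Lemma open_cylinder (R : realType) (d : nat) (Omega : set 'cV[R]_d) (T : R) :
  open Omega -> open (cylinder Omega T).
Proof.
move=> oO; rewrite openE => -[x t] [Ox tT]; exists (Omega, `]0, T[%classic) => //.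
by split; apply: open_nbhs_nbhs; split=> //; exact: itv_open.
Qed.

Lemma subset_cylinder (R : realType) (d : nat) (Omega : set 'cV[R]_d) (T : R) :
  cylinder Omega T `<=` closed_cylinder Omega T.
Proof.
move=> [x t] [/= Ox]; rewrite in_itv /= => /andP[t0 tT].
by split; [exact: subset_closure|rewrite /= in_itv /= !ltW].
Qed.

(** The point [(x, t)] is the limit of [(y, t + e (T / 2 - t))] with [y] in Omega tending to [x] and
    [e] tending to 0 from the right: moving towards the midpoint [T / 2] puts the time strictly
    between 0 and [T]. *)
Lemma closed_cylinder_subset_closure (R : realType) (d : nat)
    (Omega : set 'cV[R]_d) (T : R) :
  0 < T -> closed_cylinder Omega T `<=` closure (cylinder Omega T).
Proof.
move=> T0 [x t] [/= Ox]; rewrite in_itv /= => /andP[t0 tT].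
have [G PG [Gx GO]] : exists2 G : set_system 'cV[R]_d, ProperFilter G &
    G --> x /\ globally Omega `<=` G by move: Ox; rewrite closureEcvg.
have c2 : z.2 @[z --> filter_prod G (0 : R)^'+] --> (0 : R).
  by apply: cvg_trans (@cvg_snd _ _ G (0 : R)^'+ _) _; exact: cvg_within.
have c1 : z.1 @[z --> filter_prod G (0 : R)^'+] --> x.
  by apply: cvg_trans Gx; exact: cvg_fst.
have c3 : t + z.2 * (T / 2 - t) @[z --> filter_prod G (0 : R)^'+] --> t.
  rewrite -[X in _ --> X]addr0 -[X in _ --> _ + X](mul0r (T / 2 - t)).
  by apply: cvgD; [exact: cvg_cst|apply: cvgM c2 _; exact: cvg_cst].
have c4 : (z.1, t + z.2 * (T / 2 - t))
    @[z --> filter_prod G (0 : R)^'+] --> (x, t) by exact: cvg_pair c1 c3.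
apply: (closed_cvg _ (@closed_closure _ _) _ _ c4).
near=> z; apply: subset_closure; split => /=.
  near: z; exists (Omega, setT) => //=; last by move=> ? [].
  by split; [apply: GO|exact: filterT].
have z0 : 0 < z.2.
  by near: z; exists (setT, [set e | 0 < e]) => [|? []//]; split => /=;
     [exact: filterT|exact: nbhs_right_gt].
have z1 : z.2 < 1.
  by near: z; exists (setT, [set e | e < 1]) => [|? []//]; split => /=;
     [exact: filterT|exact: nbhs_right_lt].
rewrite in_itv /=; apply/andP; split; nra.
Unshelve. all: by end_near. Qed.

(** The trace of the neighbourhoods of [p] on the open cylinder is a proper filter and limits are
    unique, so any continuous extension computes the [lim] in [partial]. *)
Lemma partial_extension (R : realType) (d : nat) (Omega : set 'cV[R]_d) (T : R)
    (W : normedModType R) i (f g : 'cV[R]_d * R -> W) p :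
  0 < T -> {within closed_cylinder Omega T, continuous g} ->
  (forall q, cylinder Omega T q -> g q = 'D_(dir i) f q) ->
  closed_cylinder Omega T p -> partial Omega T i f p = g p.
Proof.
move=> T0 cg gE cp.
have cyl_near : \forall q \near within (cylinder Omega T) (nbhs p), cylinder Omega T q.
  exact: withinT.
have PF : ProperFilter (within (cylinder Omega T) (nbhs p)).
  exact/within_nbhs_proper/closed_cylinder_subset_closure.
apply: cvg_lim; first exact: norm_hausdorff.
have : g q @[q --> within (cylinder Omega T) (nbhs p)] --> g p.
  apply: within_continuous_cvg cg cp _ _; last exact: cvg_within.
  by apply: filterS cyl_near; exact: subset_cylinder.
apply: cvg_trans; apply: near_eq_cvg.
by apply: filterS cyl_near => q /gE.
Qed.

Lemma compact_within_bounded (R : realType) (S : topologicalType)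
    (W : normedModType R) (A : set S) (g : S -> W) :
  compact A -> {within A, continuous g} ->
  exists2 K : R, 0 <= K & forall p, A p -> `|g p| <= K.
Proof.
move=> cA cg; have [M [Mr MA]] := compact_bounded (continuous_compact cg cA).
exists (`|M| + 1) => [|p Ap]; first by rewrite addr_ge0.
apply: MA; last by exists p.
by rewrite (le_lt_trans (ler_norm M)) // ltrDl.
Qed.

Lemma C_upto_boundary_bounded (R : realType) (d : nat) (Omega : set 'cV[R]_d)
    (T : R) (W : normedModType R) (m : nat) (f : 'cV[R]_d * R -> W) :
  bounded_set Omega -> C_upto_boundary Omega T m f ->
  exists2 K : R, 0 <= K & forall s p, (size s <= m)%N -> cylinder Omega T p ->
    `|pderiv s f p| <= K.
Proof.
move=> bO [_ _ ext].
have {}ext s : exists K : R, 0 <= K /\ ((size s <= m)%N ->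
    forall p, cylinder Omega T p -> `|pderiv s f p| <= K).
  case: (leqP (size s) m) => [/ext [g [cg gE]]|_]; last by exists 0.
  have [K K0 gK] := compact_within_bounded (closed_cylinder_compact bO) cg.
  by exists K; split=> // _ p cp; rewrite -gE //; apply/gK/subset_cylinder.
have [K KP] := choice ext.
(* There are finitely many words of length at most [m], so the sum of their bounds is a common
   bound. *)
exists (\sum_(k < m.+1) \sum_(s : k.-tuple (option 'I_d)) K s).
  by apply: sumr_ge0 => k _; apply: sumr_ge0 => s _; case: (KP s).
move=> s p sm cp; apply: le_trans ((KP s).2 sm p cp) _.
have sm' : (size s < m.+1)%N by [].
rewrite (bigD1 (Ordinal sm')) //= (bigD1 (in_tuple s)) //= -addrA lerDl.
rewrite addr_ge0 //; first by apply: sumr_ge0 => t _; case: (KP t).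
by apply: sumr_ge0 => k _; apply: sumr_ge0 => t _; case: (KP t).
Qed.

(** * Directional derivatives inside the cylinder *)

Lemma pderiv_continuous (R : realType) (d : nat) (Omega : set 'cV[R]_d)
    (T : R) (W : normedModType R) (m : nat) (f : 'cV[R]_d * R -> W) s p :
  open Omega -> C_upto_boundary Omega T m f -> (size s <= m)%N ->
  cylinder Omega T p -> {for p, continuous (pderiv s f)}.
Proof.
move=> oO [_ _ ext] /ext [g [cg gE]] cp.
have cyl_near : \forall q \near p, cylinder Omega T q.
  by apply: open_nbhs_nbhs; split=> //; exact: open_cylinder.
rewrite /prop_for /continuous_at -gE //.
have : g q @[q --> p] --> g p.
  apply: within_continuous_cvg cg _ _ _; [exact: subset_cylinder| |exact: cvg_id].
  by apply: filterS cyl_near; exact: subset_cylinder.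
by apply: cvg_trans; apply: near_eq_cvg; apply: filterS cyl_near => q /gE.
Qed.

(** Continuity of the partial derivatives makes the derivative linear in the direction. The
    statement is entrywise because the mean value theorem is applied to real functions. *)
Lemma is_derive_pderiv (R : realType) (d k l : nat) (Omega : set 'cV[R]_d)
    (T : R) (m : nat) (f : 'cV[R]_d * R -> 'M[R]_(k, l)) s p a b
    (c : option 'I_d -> R) :
  open Omega -> C_upto_boundary Omega T m f -> (size s < m)%N ->
  cylinder Omega T p ->
  is_derive p (\sum_i c i *: dir i) (fun q => pderiv s f q a b)
    (\sum_i c i * pderiv (i :: s) f p a b).
Proof.
move=> oO Cf sm cp.
apply: (@is_derive_lin_comb _ _ _ _ _ (fun i q => pderiv (i :: s) f q a b)) => i.
  have : \forall q \near p, cylinder Omega T q.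
    by apply: open_nbhs_nbhs; split=> //; exact: open_cylinder.
  apply: filterS => q cq; apply: is_derive_entry; apply: derivableP.
  by case: Cf => _ + _; apply.
have := @pderiv_continuous _ _ _ _ _ _ _ (i :: s) _ oO Cf sm cp.
by move=> h; exact: (continuous_comp h (@coord_continuous R k l a b _)).
Qed.

(** For smooth [f] this is the [n]-fold derivative of an entry of [pderiv s f] in the fixed
    direction [\sum_i c i *: dir i]. It is expanded into partial derivatives, with [s] as
    accumulator of directions, so that bounds on these carry over. *)
Fixpoint dir_deriv (R : realType) (d k l : nat)
    (f : 'cV[R]_d * R -> 'M[R]_(k, l)) (c : option 'I_d -> R) a b n s p : R :=
  if n is n'.+1 then \sum_i c i * dir_deriv f c a b n' (i :: s) p
  else pderiv s f p a b.

Lemma is_derive_bigsum (R : realType) (V : normedModType R) (I : Type)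
    (r : seq I) (F : I -> V -> R) (D : I -> R) (p v : V) (c : I -> R) :
  (forall i, is_derive p v (F i) (D i)) ->
  is_derive p v (fun q => \sum_(i <- r) c i * F i q) (\sum_(i <- r) c i * D i).
Proof.
move=> FD; elim: r => [|i r IHr].
  rewrite big_nil (_ : (fun _ => _) = cst 0); first exact: is_derive_cst.
  by apply/funext => q; rewrite big_nil.
rewrite big_cons (_ : (fun _ => _) =
  (c i \*: F i) + (fun q => \sum_(j <- r) c j * F j q)).
  exact: (is_deriveD (is_deriveZ _ (FD i)) IHr).
by apply/funext => q; rewrite big_cons.
Qed.

(** The recursion adds the innermost direction first while differentiation acts outermost; since the
    coefficients are constant, induction on [n] with [s] arbitrary reconciles the two. *)
Lemma is_derive_dir_deriv (R : realType) (d k l : nat) (Omega : set 'cV[R]_d)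
    (T : R) (m : nat) (f : 'cV[R]_d * R -> 'M[R]_(k, l)) n s p a b
    (c : option 'I_d -> R) :
  open Omega -> C_upto_boundary Omega T m f -> (size s + n < m)%N ->
  cylinder Omega T p ->
  is_derive p (\sum_i c i *: dir i) (dir_deriv f c a b n s)
    (dir_deriv f c a b n.+1 s p).
Proof.
move=> oO Cf + cp; elim: n s => [|n IHn] s.
  by rewrite addn0 => sm; exact: (is_derive_pderiv a b c oO Cf sm cp).
rewrite addnS => sm; apply: is_derive_bigsum => i.
exact: IHn.
Qed.

Lemma dir_deriv_bounded (R : realType) (d k l : nat)
    (m : nat) (f : 'cV[R]_d * R -> 'M[R]_(k, l)) n s p a b
    (c : option 'I_d -> R) (K : R) :
  (forall s, (size s <= m)%N -> `|pderiv s f p| <= K) -> (size s + n <= m)%N ->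
  `|dir_deriv f c a b n s p| <= (\sum_i `|c i|) ^+ n * K.
Proof.
move=> fK; elim: n s => [|n IHn] s.
  rewrite addn0 mul1r => sm /=; exact: le_trans (entry_ler_norm _ _ _) (fK _ sm).
rewrite addnS => sm /=; apply: le_trans (ler_norm_sum _ _ _) _.
rewrite exprS -mulrA mulr_suml; apply: ler_sum => i _.
by rewrite normrM ler_wpM2l // IHn.
Qed.

(** * Backward differences along a line *)

Lemma MVT_bound (R : realType) (f df : R -> R) (a b K : R) :
  a <= b -> (forall x : R, x \in `[a, b] -> is_derive x 1 f (df x)) ->
  (forall x : R, x \in `[a, b] -> `|df x| <= K) -> `|f b - f a| <= K * (b - a).
Proof.
move=> ab fd dfK; have [c cab ->] := MVT_closed ab fd.
by rewrite normrM (ger0_norm (_ : 0 <= b - a)) ?subr_ge0 // ler_wpM2r ?subr_ge0 ?dfK.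
Qed.

(** The bound on [f3] is carried up to [f2], [f1] and [f] by three uses of the mean value
    inequality. The factor [1 / 6] is given up, which keeps each step elementary. *)
Lemma taylor2_remainder (R : realType) (f f1 f2 f3 : R -> R) (a K : R) :
  (forall s : R, s \in `[0, a] -> is_derive s 1 f (f1 s)) ->
  (forall s : R, s \in `[0, a] -> is_derive s 1 f1 (f2 s)) ->
  (forall s : R, s \in `[0, a] -> is_derive s 1 f2 (f3 s)) ->
  (forall s : R, s \in `[0, a] -> `|f3 s| <= K) ->
  forall s : R, s \in `[0, a] ->
    `|f s - f 0 - s * f1 0 - s ^+ 2 / 2 * f2 0| <= K * s ^+ 3.
Proof.
move=> df df1 df2 f3K.
have sub (s r : R) : s \in `[0, a] -> r \in `[0, s] -> r \in `[0, a].
  rewrite !in_itv /= => /andP[_ sa] /andP[-> rs] /=; exact: le_trans rs sa.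
have ge0 (s : R) : s \in `[0, a] -> 0 <= s by rewrite in_itv /= => /andP[].
have K0 (s : R) : s \in `[0, a] -> 0 <= K.
  by move=> /f3K; apply: le_trans.
have b2 (s : R) : s \in `[0, a] -> `|f2 s - f2 0| <= K * s.
  move=> sa; rewrite -[X in _ <= K * X]subr0.
  by apply: MVT_bound (ge0 _ sa) _ _ => r /(sub _ _ sa); [exact: df2|exact: f3K].
have b1 (s : R) : s \in `[0, a] -> `|f1 s - f1 0 - s * f2 0| <= K * s ^+ 2.
  move=> sa.
  have d1 (r : R) : r \in `[0, s] ->
      is_derive r 1 (fun r => f1 r - f1 0 - r * f2 0) (f2 r - f2 0).
    move=> rs; have dr := df1 _ (sub _ _ sa rs).
    rewrite (_ : (fun _ => _) = f1 - cst (f1 0) - (f2 0 \*: id)); last first.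
      by apply/funext => z /=; rewrite [z * _]mulrC.
    by apply: is_derive_eq; rewrite subr0 [_ *: _]mulr1.
  have d2 (r : R) : r \in `[0, s] -> `|f2 r - f2 0| <= K * s.
    move=> rs; rewrite (le_trans (b2 _ (sub _ _ sa rs))) // ler_wpM2l ?(K0 _ sa) //.
    by move: rs; rewrite in_itv /= => /andP[].
  have := MVT_bound (ge0 _ sa) d1 d2.
  by rewrite subrr mul0r !subr0 -mulrA -expr2.
move=> s sa.
have d1 (r : R) : r \in `[0, s] ->
    is_derive r 1 (fun r => f r - f 0 - r * f1 0 - r ^+ 2 / 2 * f2 0)
      (f1 r - f1 0 - r * f2 0).
  move=> rs; have dr := df _ (sub _ _ sa rs).
  rewrite (_ : (fun _ => _) =
    f - cst (f 0) - (f1 0 \*: id) - ((f2 0 / 2) \*: (id * id))); last first.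
    apply/funext => z.
    by rewrite -[RHS]/(f z - f 0 - f1 0 * z - f2 0 / 2 * (z * z)); field.
  by apply: is_derive_eq; rewrite /GRing.scale /=; field.
have d2 (r : R) : r \in `[0, s] -> `|f1 r - f1 0 - r * f2 0| <= K * s ^+ 2.
  move=> rs; rewrite (le_trans (b1 _ (sub _ _ sa rs))) // ler_wpM2l ?(K0 _ sa) //.
  by move: rs; rewrite in_itv /= => /andP[r0 rs]; rewrite ler_pXn2r // nnegrE (ge0 _ sa).
have := MVT_bound (ge0 _ sa) d1 d2.
by rewrite subrr mul0r expr0n /= !mul0r !subr0 [s ^+ 3]exprSr [K * (_ * _)]mulrA.
Qed.

Lemma backward_differences_bound (R : realType) (f f1 f2 f3 : R -> R) (h K : R) :
  0 <= h ->
  (forall s : R, s \in `[0, 2 * h] -> is_derive s 1 f (f1 s)) ->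
  (forall s : R, s \in `[0, 2 * h] -> is_derive s 1 f1 (f2 s)) ->
  (forall s : R, s \in `[0, 2 * h] -> is_derive s 1 f2 (f3 s)) ->
  (forall s : R, s \in `[0, 2 * h] -> `|f1 s| <= K) ->
  (forall s : R, s \in `[0, 2 * h] -> `|f2 s| <= K) ->
  (forall s : R, s \in `[0, 2 * h] -> `|f3 s| <= K) ->
  [/\ `|f (2 * h) - f h| <= K * h,
      `|f 0 - 2 * f h + f (2 * h)| <= 2 * K * h ^+ 2 &
      `|2 * h * f1 0 + 3 * f 0 - 4 * f h + f (2 * h)| <= 12 * K * h ^+ 3].
Proof.
move=> h0 df df1 df2 f1K f2K f3K.
have hh : h <= 2 * h by lra.
have m0 : (0 : R) \in `[0, 2 * h] by rewrite in_itv /= lexx mulr_ge0.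
have m1 : h \in `[0, 2 * h] by rewrite in_itv /= h0 hh.
have m2 : 2 * h \in `[0, 2 * h] by rewrite in_itv /= lexx mulr_ge0.
have K0 : 0 <= K by apply: le_trans (f1K _ m0).
have sub1 (s : R) : s \in `[0, h] -> s \in `[0, 2 * h].
  by rewrite !in_itv /= => /andP[-> sh] /=; exact: le_trans sh hh.
have sub2 (s : R) : s \in `[h, 2 * h] -> s \in `[0, 2 * h].
  by rewrite !in_itv /= => /andP[hs ->]; rewrite (le_trans h0 hs).
split.
- have := MVT_bound hh (fun s sh => df s (sub2 s sh)) (fun s sh => f1K s (sub2 s sh)).
  by rewrite (_ : 2 * h - h = h) //; ring.
(* The second difference is [h] times the difference of [f1] at mean value points [c] of [[0, h]]
   and [e] of [[h, 2h]], whose distance is at most [2h]. *)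
- have [c ch Ec] := MVT_closed h0 (fun s sh => df s (sub1 s sh)).
  have [e eh Ee] := MVT_closed hh (fun s sh => df s (sub2 s sh)).
  have ce : c <= e.
    by move: ch eh; rewrite !in_itv /= => /andP[_ ch] /andP[he _]; exact: le_trans ch he.
  have sub3 (s : R) : s \in `[c, e] -> s \in `[0, 2 * h].
    move: ch eh; rewrite !in_itv /= => /andP[c0 _] /andP[_ eh] /andP[cs se].
    by rewrite (le_trans c0 cs) (le_trans se eh).
  have B := MVT_bound ce (fun s sh => df1 s (sub3 s sh)) (fun s sh => f2K s (sub3 s sh)).
  have -> : f 0 - 2 * f h + f (2 * h) = h * (f1 e - f1 c) by lra.
  have ec : e - c <= 2 * h.
    by move: ch eh; rewrite !in_itv /= => /andP[c0 _] /andP[_ eh]; lra.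
  rewrite normrM ger0_norm //.
  have : h * `|f1 e - f1 c| <= h * (K * (2 * h)).
    by rewrite ler_wpM2l // (le_trans B) // ler_wpM2l.
  by move/le_trans; apply; rewrite le_eqVlt; apply/orP; left; apply/eqP; ring.
- have T1 := taylor2_remainder df df1 df2 f3K m1.
  have T2 := taylor2_remainder df df1 df2 f3K m2.
  set r1 := f h - _ - _ - _ in T1; set r2 := f (2 * h) - _ - _ - _ in T2.
  (* This combination annihilates the quadratic Taylor polynomial at 0, so only remainders are left;
     the constant is [12 = 2^3 + 4]. *)
  have -> : 2 * h * f1 0 + 3 * f 0 - 4 * f h + f (2 * h) = r2 - 4 * r1.
    by rewrite /r1 /r2; field.
  apply: le_trans (ler_normB _ _) _; rewrite normrM (ger0_norm (_ : 0 <= 4)) //.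
  have -> : 12 * K * h ^+ 3 = K * (2 * h) ^+ 3 + 4 * (K * h ^+ 3) by ring.
  by apply: lerD T2 _; rewrite ler_wpM2l.
Qed.

(** * Differences along a space-time line *)

Lemma sum_option (V : nmodType) (I : finType) (F : option I -> V) :
  \sum_i F i = F None + \sum_j F (Some j).
Proof.
rewrite (bigD1 None) //=; congr (_ + _).
rewrite (reindex_omap (@Some I) id) => [|[j|]] //=.
by apply: eq_bigl => j; rewrite eqxx.
Qed.

Definition dir_coord (R : realType) (d : nat) (w : 'cV[R]_d * R) i : R :=
  if i is Some j then w.1 j 0 else w.2.

Lemma dir_coordE (R : realType) (d : nat) (w : 'cV[R]_d * R) :
  \sum_i dir_coord w i *: dir i = w.
Proof.
rewrite sum_option; apply: injective_projections => /=.
  rewrite scaler0 add0r (big_morph fst (fun _ _ => erefl) erefl) /=.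
  rewrite [RHS]matrix_sum_delta; apply: eq_bigr => i _.
  by rewrite big_ord1.
rewrite (big_morph snd (fun _ _ => erefl) erefl) /= big1 => [|i _].
  by rewrite addr0 [_ *: _]mulr1.
by rewrite [_ *: _]mulr0.
Qed.

(** The one-dimensional bounds are applied to each entry of [f] along [p + s *: w], which suffices
    for the sup norm. The assumption [1 <= V] lets [V ^+ 3 * K] bound the derivatives of orders 1, 2
    and 3 alike. *)
Lemma characteristic_differences (R : realType) (d k l : nat)
    (Omega : set 'cV[R]_d) (T : R) (f : 'cV[R]_d * R -> 'M[R]_(k, l))
    (K V h : R) (p w : 'cV[R]_d * R) :
  open Omega -> C_upto_boundary Omega T 3 f ->
  (forall s q, (size s <= 3)%N -> cylinder Omega T q -> `|pderiv s f q| <= K) ->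
  \sum_i `|dir_coord w i| <= V -> 1 <= V -> 0 <= h ->
  (forall s : R, s \in `[0, 2 * h] -> cylinder Omega T (p + s *: w)) ->
  [/\ `|f (p + (2 * h) *: w) - f (p + h *: w)| <= V ^+ 3 * K * h,
      `|f p - 2 *: f (p + h *: w) + f (p + (2 * h) *: w)|
        <= 2 * (V ^+ 3 * K) * h ^+ 2 &
      `|(2 * h) *: (\sum_i dir_coord w i *: 'D_(dir i) f p) + 3 *: f p
         - 4 *: f (p + h *: w) + f (p + (2 * h) *: w)|
        <= 12 * (V ^+ 3 * K) * h ^+ 3].
Proof.
move=> oO Cf fK wV V1 h0 cyl.
have V0 : 0 <= V by exact: le_trans ler01 V1.
have cp : cylinder Omega T p.
  have := cyl 0; rewrite scale0r addr0; apply.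
  by rewrite in_itv /= lexx mulr_ge0.
have K0 : 0 <= K by apply: le_trans (fK [::] p isT cp).
pose F a b n (s : R) := dir_deriv f (dir_coord w) a b n [::] (p + s *: w).
have F_bound a b n (s : R) : (n <= 3)%N -> s \in `[0, 2 * h] ->
    `|F a b n s| <= V ^+ 3 * K.
  move=> n3 sh.
  have H := @dir_deriv_bounded _ _ _ _ 3 f n [::] (p + s *: w) a b (dir_coord w) K.
  apply: le_trans (H _ n3) _; first by move=> r r3; apply: fK => //; exact: cyl.
  rewrite ler_wpM2r //; apply: (@le_trans _ _ (V ^+ n)).
    by rewrite lerXn2r // nnegrE // sumr_ge0.
  exact: ler_weXn2l.
have F_der a b n (s : R) : (n < 3)%N -> s \in `[0, 2 * h] ->
    is_derive s 1 (F a b n) (F a b n.+1 s).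
  move=> n3 sh; apply: is_derive_line.
  have := @is_derive_dir_deriv _ _ _ _ Omega T 3 f n [::] (p + s *: w) a b
    (dir_coord w) oO Cf n3 (cyl _ sh).
  by rewrite dir_coordE.
have M0 : 0 <= V ^+ 3 * K by rewrite mulr_ge0 // exprn_ge0.
have B a b := @backward_differences_bound _ (F a b 0%N) (F a b 1%N) (F a b 2%N)
  (F a b 3%N) h (V ^+ 3 * K) h0 (fun s => @F_der a b 0%N s isT)
  (fun s => @F_der a b 1%N s isT) (fun s => @F_der a b 2%N s isT)
  (fun s => @F_bound a b 1%N s isT) (fun s => @F_bound a b 2%N s isT)
  (fun s => @F_bound a b 3%N s isT).
split; apply: mx_norm_ler; rewrite ?mulr_ge0 ?exprn_ge0 // => a b;
  have [B1 B2 B3] := B a b.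
- by rewrite !mxE.
- by move: B2; rewrite /F scale0r addr0 !mxE.
- move: B3; rewrite /F scale0r addr0 !mxE /= summxE.
  by under [in X in _ -> X]eq_bigr do rewrite mxE.
Qed.

(** * Characteristics stay in the domain *)

(** The parameters in [[0, s]] at which the path is outside [A] form a nonempty compact set, and [r]
    is its minimum. The point [g r] is outside [A] but is a limit from the left of points of [A],
    hence on the boundary. *)
Lemma first_exit (R : realType) (S : topologicalType) (A : set S)
    (g : R -> S) (s : R) :
  open A -> continuous g -> A (g 0) -> 0 <= s -> ~ A (g s) ->
  exists r : R, [/\ 0 < r <= s, boundary A (g r) &
                    forall r', 0 <= r' < r -> A (g r')].
Proof.
move=> oA cg Ag0 s0 nAgs.
pose B := `[0, s]%classic `&` g @^-1` (~` A).
have B0 : B !=set0 by exists s; split=> //=; rewrite in_itv /= s0 lexx.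
have cB : compact B.
  apply: (@subclosed_compact _ _ `[0, s]%classic); last by move=> ? [].
    apply: closedI; first exact: itv_closed.
    by apply: closed_comp => [? _|]; [exact: cg|exact: open_closedC].
  exact: segment_compact.
have cid_B : {within B, continuous (id : R -> R)}.
  by apply: continuous_subspaceT => ?; exact: cvg_id.
have [r] := compact_EVT_min B0 cB cid_B.
rewrite inE => -[/=]; rewrite in_itv /= => /andP[r0 rs] nAgr rmin.
have inA r' : 0 <= r' < r -> A (g r').
  move=> /andP[r'0 r'r]; apply: contrapT => nA; move: (r'r).
  rewrite ltNge rmin // inE; split=> //=.
  by rewrite in_itv /= r'0 (le_trans (ltW r'r)).
have r1 : 0 < r by rewrite lt_neqAle r0 andbT; apply/eqP => r00; apply: nAgr; rewrite -r00.
exists r; split=> //; first by rewrite r1.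
split; last by move/interior_subset.
have : g r' @[r' --> r^'-] --> g r by apply: cvg_within_filter; exact: cg.
apply: (closed_cvg _ (@closed_closure _ A)).
near=> r'; apply/subset_closure/inA; apply/andP; split.
  by near: r'; exact: nbhs_left_ge.
by near: r'; exact: nbhs_left_lt.
Unshelve. all: by end_near. Qed.

Lemma continuous_affine_path (R : realType) (V : normedModType R) (p w : V) :
  continuous (fun s : R => p + s *: w).
Proof.
by move=> s; apply: cvgD; [exact: cvg_cst|apply: cvgZ; [exact: cvg_id|exact: cvg_cst]].
Qed.

Lemma characteristic_stays_inside (R : realType) (d : nat)
    (Omega : set 'cV[R]_d) (T : R) (u : 'cV[R]_d * R -> 'cV[R]_d)
    (x : 'cV[R]_d) (t h : R) :
  (d <= 3)%N -> open Omega -> C_upto_boundary Omega T 1 u ->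
  (forall y, boundary Omega y -> u (y, t) = 0) ->
  Omega x -> 0 < t < T -> 0 <= h ->
  (forall y i j, Omega y -> h * `|('D_(dir (Some j)) u (y, t)) i 0| <= 8^-1) ->
  forall s : R, s \in `[0, 2 * h] -> Omega (x - s *: u (x, t)).
Proof.
move=> d3 oO Cu u0 Ox tT h0 hu s; rewrite in_itv /= => /andP[s0 sh].
apply: contrapT => nO; set v := u (x, t) in nO *.
have [||||r [/andP[r0 rs] br inO]] :=
  @first_exit R _ Omega (fun s => x + s *: (- v)) s oO.
- exact: continuous_affine_path.
- by rewrite scale0r addr0.
- exact: s0.
- by rewrite scalerN.
pose w : 'cV[R]_d * R := (- v, 0).
have pathE (z : R) : (x, t) + z *: w = (x + z *: (- v), t).
  by apply: injective_projections; rewrite //= [_ *: 0]mulr0 addr0.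
have cyl z : 0 <= z < r -> cylinder Omega T ((x, t) + z *: w).
  by move=> zr; rewrite pathE; split=> /=; [exact: inO|rewrite in_itv].
have ccyl z : 0 <= z <= r -> closed_cylinder Omega T ((x, t) + z *: w).
  move=> /andP[z0]; rewrite le_eqVlt => /predU1P[->|zr]; last first.
    by apply: subset_cylinder; apply: cyl; rewrite z0.
  rewrite pathE; split=> /=; first by case: br.
  by case/andP: tT => ? ?; rewrite in_itv /= !ltW.
(* [u] vanishes at the exit point [x - r v], so each entry of [v] is minus the
   increment of an entry of [u] along the segment. *)
have v_le i : `|v i 0| <= 3 / 4 * `|v|.
  pose psi (z : R) := u ((x, t) + z *: w) i 0.
  have [||z zr] := @MVT _ psi (fun z => \sum_k dir_coord w k *
      pderiv [:: k] u ((x, t) + z *: w) i 0) 0 r r0.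
  - move=> z; rewrite in_itv /= => /andP[z0 zr].
    apply: (@is_derive_line _ _ (fun q => u q i 0)).
    have cz : cylinder Omega T ((x, t) + z *: w) by apply: cyl; rewrite ltW.
    have := @is_derive_pderiv _ _ _ _ Omega T 1 u [::] _ i 0 (dir_coord w) oO Cu isT cz.
    by rewrite dir_coordE.
  (* The exit point at [r] is on the boundary, so continuity up to the endpoint comes from
     continuity of [u] on the closed cylinder. *)
  - apply/subspace_continuousP => z zr.
    suff H : u ((x, t) + y *: w) @[y --> within `[0, r] (nbhs z)] --> u ((x, t) + z *: w).
      exact: (cvg_comp _ _ H (@coord_continuous R _ _ i 0 _)).
    case: Cu => cu _ _.
    apply: (@within_continuous_cvg _ _ _ _ u (within `[0, r] (nbhs z))
      (fun y => (x, t) + y *: w) ((x, t) + z *: w) _ cu).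
    + by apply: ccyl; move: zr; rewrite /= in_itv.
    + have : \forall y \near within `[0, r] (nbhs z), `[0, r]%classic y by exact: withinT.
      by apply: filterS => y; rewrite /= in_itv /= => yr; exact: ccyl.
    + by apply: cvg_within_filter; exact: continuous_affine_path.
  rewrite /psi scale0r addr0 -/v pathE u0 // mxE sub0r subr0 => /(congr1 Num.norm).
  rewrite normrN -/v => ->; rewrite sum_option mul0r add0r normrM (ger0_norm (ltW r0)).
  set q := (x, t) + z *: w.
  have cq : cylinder Omega T q.
    by apply: cyl; move: zr; rewrite in_itv /= => /andP[/ltW -> ->].
  have q2 : q = (x + z *: (- v), t) by rewrite /q pathE.
  apply: (@le_trans _ _ ((\sum_(j < d) `|v| * `|pderiv [:: Some j] u q i 0|) * (2 * h))).
    apply: ler_pM => //; [exact: ltW| |exact: le_trans rs sh].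
    apply: le_trans (ler_norm_sum _ _ _) _; apply: ler_sum => j _.
    by rewrite normrM ler_wpM2r //= mxE normrN entry_ler_norm.
  rewrite mulr_suml.
  (* Each space direction contributes at most [2 / 8], and [d <= 3] gives the factor [3 / 4 < 1]. *)
  apply: (@le_trans _ _ (\sum_(j < d) `|v| * (2 * 8^-1))).
    apply: ler_sum => j _; rewrite -mulrA ler_wpM2l // mulrCA [_ * h]mulrC.
    by rewrite ler_pM2l // q2 hu //; case: cq; rewrite q2.
  rewrite sumr_const card_ord -[leLHS]mulr_natl.
  have : (d%:R : R) <= 3 by rewrite (ler_nat R d 3).
  have := normr_ge0 v; nra.
have : `|v| <= 3 / 4 * `|v|.
  by apply: mx_norm_ler => [|i j]; [rewrite mulr_ge0|rewrite ord1].
have v0 := normr_ge0 v => vv.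
have /normr0_eq0 vE : `|v| = 0 by lra.
by apply: nO; rewrite vE scaler0 subr0.
Qed.

(** * From the essential supremum to a pointwise gradient bound *)

Lemma entry_ler_frobenius (R : realType) (m n : nat) (A : 'M[R]_(m, n)) i j :
  `|A i j| <= frobenius A.
Proof.
rewrite -sqrtr_sqr ler_wsqrtr // (bigD1 i) //= (bigD1 j) //= -addrA lerDl.
by rewrite addr_ge0 // !sumr_ge0 // => *; rewrite ?sumr_ge0 // => *; exact: sqr_ge0.
Qed.

Lemma cvg_sumr (R : realType) (U I : Type) (V : normedModType R)
    (F : set_system U) (r : seq I) (f : I -> U -> V) (l : I -> V) :
  Filter F -> (forall i, f i z @[z --> F] --> l i) ->
  \sum_(i <- r) f i z @[z --> F] --> \sum_(i <- r) l i.
Proof.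
by move=> FF fl; apply: cvg_big => //; exact: add_continuous.
Qed.

Lemma frobenius_continuous (R : realType) (m n : nat) :
  continuous (@frobenius R m n).
Proof.
move=> A; apply: (@continuous_comp _ _ _ (fun A : 'M[R]_(m, n) =>
  \sum_i \sum_j A i j ^+ 2) Num.sqrt); last exact: sqrt_continuous.
apply: (@cvg_sumr _ _ _ _ (nbhs A)) => i; apply: (@cvg_sumr _ _ _ _ (nbhs A)) => j.
exact: (cvg_comp _ _ (@coord_continuous R m n i j A) (@exprn_continuous R 2 _)).
Qed.

Lemma cvg_mx_entries (R : realType) (U : Type) (m n : nat) (F : set_system U)
    (f : U -> 'M[R]_(m, n)) (l : 'M[R]_(m, n)) :
  Filter F -> (forall i j, f z i j @[z --> F] --> l i j) -> f z @[z --> F] --> l.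
Proof.
move=> FF fl; apply/cvgrPdist_le => e e0; near=> z.
apply: mx_norm_ler; first exact: ltW.
near: z; apply: filter_forall => i; apply: filter_forall => j.
by have /cvgrPdist_le/(_ _ e0) := fl i j; apply: filterS => z; rewrite !mxE.
Unshelve. all: by end_near. Qed.

(** At an interior time the Frobenius norm of the gradient is continuous in Omega, so the essential
    supremum dominates its value at [y], which in turn dominates each entry. *)
Lemma grad_bound (R : realType) (d : nat) (Omega : set 'cV[R]_d) (T : R)
    (u : 'cV[R]_d * R -> 'cV[R]_d) (h t : R) (y : 'cV[R]_d) i j :
  open Omega -> 0 < T -> C_upto_boundary Omega T 1 u -> 0 < h ->
  (h%:E * C0W1inf_norm Omega T u <= (8^-1)%:E)%E ->
  0 < t < T -> Omega y -> h * `|('D_(dir (Some j)) u (y, t)) i 0| <= 8^-1.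
Proof.
move=> oO T0 Cu h0 hN tT Oy.
have gradE z : Omega z -> grad Omega T u (z, t) =
    \matrix_(i, j) (pderiv [:: Some j] u (z, t)) i 0.
  move=> Oz; apply/matrixP => k l; rewrite !mxE.
  case: Cu => _ _ /(_ [:: Some l] isT) [g [cg gE]].
  have cz : cylinder Omega T (z, t) by split=> //=; rewrite in_itv.
  by rewrite (partial_extension T0 cg gE) ?gE //; exact: subset_cylinder.
pose f z := frobenius (grad Omega T u (z, t)).
have cf : {for y, continuous f}.
  apply: (@continuous_comp _ _ _ (fun z => grad Omega T u (z, t)));
    last exact: frobenius_continuous.
  have ny : \forall z \near y, Omega z by apply: open_nbhs_nbhs.
  rewrite /prop_for /continuous_at (gradE y) //.
  suff : \matrix_(i, j) (pderiv [:: Some j] u (z, t)) i 0 @[z --> y] -->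
      (\matrix_(i, j) (pderiv [:: Some j] u (y, t)) i 0 : 'M[R]_d).
    apply: cvg_trans; apply: (@near_eq_cvg _ _ (nbhs y)).
    by apply: filterS ny => z Oz; rewrite gradE.
  apply: (@cvg_mx_entries _ _ _ _ (nbhs y)) => k l; under eq_fun do rewrite mxE; rewrite mxE.
  have cy : cylinder Omega T (y, t) by split=> //=; rewrite in_itv.
  have H := @pderiv_continuous _ _ _ _ _ _ _ [:: Some l] _ oO Cu isT cy.
  have H1 : (z, t) @[z --> y] --> (y, t).
    exact: (cvg_pair (@cvg_id _ (nbhs y)) (cvg_cst t)).
  exact: (cvg_comp _ _ (cvg_comp _ _ H1 H) (@coord_continuous R _ _ k 0 _)).
rewrite -lee_fin; apply: le_trans hN; rewrite EFinM.
apply: lee_wpmul2l; first by rewrite lee_fin ltW.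
have le1 : (`|('D_(dir (Some j)) u (y, t)) i 0|%:E <= (f y)%:E)%E.
  rewrite lee_fin; apply: le_trans (entry_ler_frobenius _ i j).
  by rewrite gradE // mxE.
apply: (le_trans le1); apply: (le_trans (le_ess_sup_on oO Oy cf)).
apply: ereal_sup_ubound; exists t => //=.
by case/andP: tT => ? ?; rewrite in_itv /= !ltW.
Qed.

(** * Up to the boundary *)

(** The three inequalities are closed conditions and both sides depend continuously on base point,
    direction and step, so they pass to the limit from interior points. *)
Lemma characteristic_differences_closure (R : realType) (d k l : nat)
    (Omega : set 'cV[R]_d) (T : R) (u : 'cV[R]_d * R -> 'cV[R]_d)
    (f : 'cV[R]_d * R -> 'M[R]_(k, l)) (K V h t : R) (x : 'cV[R]_d) :
  let p := (x, t) in let w := (- u p, -1) in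
  (d <= 3)%N -> open Omega -> bounded_set Omega -> 0 < T ->
  C_upto_boundary Omega T 1 u ->
  (forall y s, boundary Omega y -> 0 <= s <= T -> u (y, s) = 0) ->
  C_upto_boundary Omega T 3 f ->
  (forall s q, (size s <= 3)%N -> cylinder Omega T q -> `|pderiv s f q| <= K) ->
  (forall q, closed_cylinder Omega T q -> \sum_i `|dir_coord (- u q, -1) i| <= V) ->
  1 <= V -> 0 < h ->
  (forall y s i j, Omega y -> 0 < s < T ->
    h * `|('D_(dir (Some j)) u (y, s)) i 0| <= 8^-1) ->
  closure Omega x -> 2 * h <= t <= T ->
  [/\ `|f (p + (2 * h) *: w) - f (p + h *: w)| <= V ^+ 3 * K * h,
      `|f p - 2 *: f (p + h *: w) + f (p + (2 * h) *: w)|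
        <= 2 * (V ^+ 3 * K) * h ^+ 2 &
      `|(2 * h) *: (\sum_i dir_coord w i *: partial Omega T i f p) + 3 *: f p
         - 4 *: f (p + h *: w) + f (p + (2 * h) *: w)|
        <= 12 * (V ^+ 3 * K) * h ^+ 3].
Proof.
move=> p w d3 oO bO T0 Cu u0 Cf fK uV V1 h0 hu Ox /andP[ht tT].
have [G PG [Gx GO]] : exists2 G : set_system 'cV[R]_d, ProperFilter G &
    G --> x /\ globally Omega `<=` G by move: Ox; rewrite closureEcvg.
(* The base point is [(y, (1 - e) t)] and the step [(1 - 2 e) h], where [y]
   tends to [x] in Omega and [e] tends to 0 from the right. *)
pose F := filter_prod G (0 : R)^'+.
pose P0 (z : 'cV[R]_d * R) : 'cV[R]_d * R := (z.1, t + z.2 * (- t)).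
pose h' (z : 'cV[R]_d * R) := h + z.2 * (- (2 * h)).
pose W z : 'cV[R]_d * R := (- u (P0 z), -1).
have c2 : z.2 @[z --> F] --> (0 : R).
  by apply: cvg_trans (@cvg_snd _ _ G (0 : R)^'+ _) _; exact: cvg_within.
have affine (a b : R) : a + z.2 * b @[z --> F] --> a.
  rewrite -[X in _ --> X]addr0 -[X in _ --> _ + X](mul0r b).
  by apply: cvgD; [exact: cvg_cst|apply: cvgM c2 _; exact: cvg_cst].
have c1 : z.1 @[z --> F] --> x by apply: cvg_trans Gx; exact: cvg_fst.
have ch : h' z @[z --> F] --> h by exact: affine.
have cP0 : P0 z @[z --> F] --> p by exact: (cvg_pair c1 (affine t (- t))).
(* The bound [2^-1] keeps the reduced step [(1 - 2 e) h] nonnegative. *)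
have good : \forall z \near F, [/\ Omega z.1, 0 < z.2 & z.2 < 2^-1].
  near=> z; split; near: z.
  - by exists (Omega, setT) => [|? []//]; split; [apply: GO|exact: filterT].
  - by exists (setT, [set e | 0 < e]) => [|? []//]; split => /=;
       [exact: filterT|exact: nbhs_right_gt].
  - by exists (setT, [set e | e < 2^-1]) => [|? []//]; split => /=;
       [exact: filterT|exact: nbhs_right_lt].
have cyl : \forall z \near F, 0 <= h' z /\
    forall s : R, s \in `[0, 2 * h' z] -> cylinder Omega T (P0 z + s *: W z).
  apply: filterS good => -[y e] /= [Oy e0 e2]; split; first by rewrite /h' /=; nra.
  have tT' : 0 < t + e * (- t) < T by apply/andP; split; nra.
  move=> s sh; split.
    have /= := @characteristic_stays_inside _ _ Omega T u y (t + e * (- t))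
      (h' (y, e)) d3 oO Cu.
    rewrite scalerN; apply=> //.
    + by move=> y' ?; apply: u0 => //; case/andP: tT' => ? ?; rewrite !ltW.
    + by rewrite /h' /=; nra.
    + move=> y' i j Oy'; apply: le_trans (hu _ _ i j Oy' tT').
      by rewrite ler_wpM2r // /h' /=; nra.
  (* Since [2 h <= t], the earliest time satisfies [(1 - e) t - 2 (1 - 2 e) h >= e t > 0]. *)
  rewrite /= in_itv /=; move: sh; rewrite in_itv /= /h' /= => /andP[s0 sh].
  rewrite [s *: -1]mulrN1; case/andP: tT' => t1 t2; apply/andP; split; nra.
have cyl0 : \forall z \near F, cylinder Omega T (P0 z).
  apply: filterS cyl => z [h'0 /(_ 0)]; rewrite scale0r addr0; apply.
  by rewrite in_itv /= lexx mulr_ge0.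
have incl0 : \forall z \near F, closed_cylinder Omega T (P0 z).
  by apply: filterS cyl0 => z; apply: subset_cylinder.
have FF : Filter F by exact: filter_prod_filter.
have cp : closed_cylinder Omega T p.
  by split=> //=; rewrite in_itv /= tT andbT; lra.
have cu : u (P0 z) @[z --> F] --> u p.
  by case: Cu => cu _ _; exact: (within_continuous_cvg FF cu cp incl0 cP0).
have cW : W z @[z --> F] --> w.
  exact: (cvg_pair (cvgN cu) (cvg_cst (-1 : R))).
have cPath (c : R) : 0 <= c <= 2 -> f (P0 z + (c * h' z) *: W z) @[z --> F] -->
    f (p + (c * h) *: w).
  move=> /andP[c0 c2'].
  have cvP : P0 z + (c * h' z) *: W z @[z --> F] --> p + (c * h) *: w.
    apply: cvgD => //; apply: cvgZ => //.
    by apply: cvgM => //; exact: cvg_cst.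
  have incl : \forall z \near F, closed_cylinder Omega T (P0 z + (c * h' z) *: W z).
    apply: filterS cyl => z [h'0 zc]; apply/subset_cylinder/zc.
    by rewrite in_itv /= mulr_ge0 // ler_wpM2r.
  (* As limits of points of the closed cylinder, which is closed, the upstream points for [x] itself
     lie in it. *)
  have clp : closed_cylinder Omega T (p + (c * h) *: w).
    apply: (closed_cvg _ _ incl _ cvP).
    by apply: compact_closed; [exact: norm_hausdorff|exact: closed_cylinder_compact].
  by case: Cf => cf _ _; exact: (within_continuous_cvg FF cf clp incl cvP).
have cP1 : f (P0 z + h' z *: W z) @[z --> F] --> f (p + h *: w).
  have := cPath 1; rewrite mul1r; under eq_fun do rewrite mul1r.
  by apply; rewrite ler01 ler1n.
have cP2 : f (P0 z + (2 * h' z) *: W z) @[z --> F] --> f (p + (2 * h) *: w).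
  by apply: cPath; rewrite lexx ler0n.
have cf0 : f (P0 z) @[z --> F] --> f p.
  by case: Cf => cf _ _; exact: (within_continuous_cvg FF cf cp incl0 cP0).
have cD i : 'D_(dir i) f (P0 z) @[z --> F] --> partial Omega T i f p.
  case: Cf => _ _ /(_ [:: i] isT) [g [cg gE]].
  rewrite (partial_extension T0 cg gE cp).
  have : g (P0 z) @[z --> F] --> g p by exact: (within_continuous_cvg FF cg cp incl0 cP0).
  apply: cvg_trans; apply: (@near_eq_cvg _ _ F).
  by apply: filterS cyl0 => z /gE.
have cdir i : dir_coord (W z) i @[z --> F] --> dir_coord w i.
  case: i => [j|] /=; last exact: cvg_cst.
  exact: (cvg_comp _ _ (cvgN cu) (@coord_continuous R _ _ j 0 _)).
have csum : \sum_i dir_coord (W z) i *: 'D_(dir i) f (P0 z) @[z --> F] -->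
    \sum_i dir_coord w i *: partial Omega T i f p.
  by apply: (@cvg_sumr _ _ _ _ F) => i; exact: cvgZ.
have bounds : \forall z \near F, [/\
    `|f (P0 z + (2 * h' z) *: W z) - f (P0 z + h' z *: W z)| <= V ^+ 3 * K * h' z,
    `|f (P0 z) - 2 *: f (P0 z + h' z *: W z) + f (P0 z + (2 * h' z) *: W z)|
      <= 2 * (V ^+ 3 * K) * h' z ^+ 2 &
    `|(2 * h' z) *: (\sum_i dir_coord (W z) i *: 'D_(dir i) f (P0 z)) + 3 *: f (P0 z)
       - 4 *: f (P0 z + h' z *: W z) + f (P0 z + (2 * h' z) *: W z)|
      <= 12 * (V ^+ 3 * K) * h' z ^+ 3].
  apply: filterS2 cyl cyl0 => z [h'0 zc] z0.
  by apply: (characteristic_differences oO Cf fK) => //; apply/uV/subset_cylinder.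
have cc (W' : normedModType R) (a : W') : a @[z --> F] --> a by exact: cvg_cst.
split.
- apply: (ler_cvg_to (cvg_norm (cvgB cP2 cP1)) (cvgM (cc _ _) ch)).
  by apply: filterS bounds => z [].
- apply: (ler_cvg_to (cvg_norm (cvgD (cvgB cf0 (cvgZ (cc _ _) cP1)) cP2))
    (cvgM (cc _ _) (cvgM ch ch))).
  by apply: filterS bounds => z [].
- apply: (ler_cvg_to (cvg_norm (cvgD (cvgB (cvgD (cvgZ (cvgM (cc _ _) ch) csum)
    (cvgZ (cc _ _) cf0)) (cvgZ (cc _ _) cP1)) cP2))
    (cvgM (cc _ _) (cvgM ch (cvgM ch ch)))).
  by apply: filterS bounds => z [].
Unshelve. all: by end_near. Qed.

(** * The truncation error *)

Lemma mx_norm_mul (R : realType) (m n p : nat) (A : 'M[R]_(m, n)) (B : 'M[R]_(n, p)) :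
  `|A *m B| <= n%:R * `|A| * `|B|.
Proof.
apply: mx_norm_ler => [|i j]; first by rewrite !mulr_ge0.
rewrite mxE; apply: le_trans (ler_norm_sum _ _ _) _.
apply: (@le_trans _ _ (\sum_(k < n) `|A| * `|B|)).
  by apply: ler_sum => k _; rewrite normrM ler_pM // entry_ler_norm.
by rewrite sumr_const card_ord -[leLHS]mulr_natl mulrA.
Qed.

Lemma mx_norm_tr (R : realType) (m n : nat) (A : 'M[R]_(m, n)) : `|A^T| <= `|A|.
Proof. by apply: mx_norm_ler => // i j; rewrite mxE entry_ler_norm. Qed.

Lemma frobenius_ler_mx_norm (R : realType) (n : nat) (A : 'M[R]_n) :
  frobenius A <= n%:R * `|A|.
Proof.
rewrite -[leRHS]ger0_norm ?mulr_ge0 // -sqrtr_sqr ler_wsqrtr //.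
apply: (@le_trans _ _ (\sum_(i < n) \sum_(j < n) `|A| ^+ 2)).
  apply: ler_sum => i _; apply: ler_sum => j _.
  by rewrite -[leLHS]real_normK ?num_real // lerXn2r // ?nnegrE // entry_ler_norm.
by rewrite !sumr_const !card_ord -[leLHS]mulr_natl -[_ ^+ 2 *+ n]mulr_natl exprMn mulrA.
Qed.

(** In the expansion the terms linear in [g] collect into the second difference of [f0], [f1], [f2],
    and the quadratic ones into the first difference [f2 - f1]. *)
Lemma bdf2_error_identity (R : realType) (d : nat) (h : R) (g f0 f1 f2 D : 'M[R]_d) :
  h != 0 ->
  (- D - g *m f0 - f0 *m g^T) - (2 * h)^-1 *: (3 *: f0
     - 4 *: ((1%:M + h *: g) *m f1 *m (1%:M + h *: g)^T)
     + (1%:M + (2 * h) *: g) *m f2 *m (1%:M + (2 * h) *: g)^T) =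
  - ((2 * h)^-1 *: (((2 * h) *: D + 3 *: f0 - 4 *: f1 + f2)
     + (2 * h) *: (g *m (f0 - 2 *: f1 + f2) + (f0 - 2 *: f1 + f2) *m g^T)
     + (4 * h ^+ 2) *: (g *m (f2 - f1) *m g^T))).
Proof.
move=> h0; rewrite ![(_ + _)^T]linearD /= !trmx1 ![(_ *: _)^T]linearZ /=.
rewrite !(mulmxDl, mulmxDr, mul1mx, mulmx1, mulNmx, mulmxN).
rewrite -?(scalemxAl, scalemxAr) ?(mulmxDl, mulmxDr, mulNmx, mulmxN).
rewrite -?(scalemxAl, scalemxAr).
(* With the matrix products abstracted, the identity is linear in them and can be checked
   entrywise. *)
move: (g *m f1 *m g^T) (g *m f2 *m g^T) => a1 a2.
move: (g *m f0) (g *m f1) (g *m f2) (f0 *m g^T) (f1 *m g^T) (f2 *m g^T).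
move=> b0 b1 b2 c0 c1 c2.
by apply/matrixP => i j; rewrite !mxE; field.
Qed.

Lemma C_upto_boundary_le (R : realType) (d : nat) (Omega : set 'cV[R]_d) (T : R)
    (W : normedModType R) (m n : nat) (f : 'cV[R]_d * R -> W) :
  (m <= n)%N -> C_upto_boundary Omega T n f -> C_upto_boundary Omega T m f.
Proof.
move=> mn [cf df ef]; split=> // [s i p sm|s sm].
  exact/df/(leq_trans sm).
exact/ef/(leq_trans sm).
Qed.

Lemma grad_bounded (R : realType) (d : nat) (Omega : set 'cV[R]_d) (T : R)
    (u : 'cV[R]_d * R -> 'cV[R]_d) :
  bounded_set Omega -> 0 < T -> C_upto_boundary Omega T 1 u ->
  exists2 K : R, 0 <= K &
    forall p, closed_cylinder Omega T p -> `|grad Omega T u p| <= K.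
Proof.
move=> bO T0 [_ _ ext].
have {}ext j : exists K : R, 0 <= K /\ forall p, closed_cylinder Omega T p ->
    `|partial Omega T (Some j) u p| <= K.
  have [g [cg gE]] := ext [:: Some j] isT.
  have [K K0 gK] := compact_within_bounded (closed_cylinder_compact bO) cg.
  by exists K; split=> // p cp; rewrite (partial_extension T0 cg gE cp) gK.
have [K KP] := choice ext.
have K0 j : 0 <= K j by case: (KP j).
exists (\sum_j K j) => [|p cp]; first exact: sumr_ge0.
apply: mx_norm_ler => [|i j]; first exact: sumr_ge0.
rewrite mxE; apply: le_trans (entry_ler_norm _ _ _) _.
apply: le_trans ((KP j).2 p cp) _.
by rewrite (bigD1 j) //= lerDl sumr_ge0.
Qed.

(** After division by [2 h], the summands [6], [4 d L] and [2 (d L)^2] come from the third, second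
    and first difference. Each matrix product costs a factor [d] in the sup norm, and the outer [d]
    compares the Frobenius norm with it. *)
Lemma bdf2_error_bound (R : realType) (d : nat) (h M L : R)
    (g f0 f1 f2 D : 'M[R]_d) :
  0 < h -> 0 <= L -> `|g| <= L -> `|f2 - f1| <= M * h ->
  `|f0 - 2 *: f1 + f2| <= 2 * M * h ^+ 2 ->
  `|(2 * h) *: D + 3 *: f0 - 4 *: f1 + f2| <= 12 * M * h ^+ 3 ->
  frobenius ((- D - g *m f0 - f0 *m g^T) - (2 * h)^-1 *: (3 *: f0
     - 4 *: ((1%:M + h *: g) *m f1 *m (1%:M + h *: g)^T)
     + (1%:M + (2 * h) *: g) *m f2 *m (1%:M + (2 * h) *: g)^T))
  <= d%:R * M * (6 + 4 * d%:R * L + 2 * (d%:R * L) ^+ 2) * h ^+ 2.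
Proof.
move=> h0 L0 gL B1 B2 B3; have h_neq0 : h != 0 by rewrite gt_eqF.
apply: le_trans (frobenius_ler_mx_norm _) _; rewrite -!mulrA ler_wpM2l //.
rewrite bdf2_error_identity // normrN normrZ.
have h2 : 0 < 2 * h by rewrite mulr_gt0.
rewrite ger0_norm ?invr_ge0 ?(ltW h2) // mulrC ler_pdivrMr //.
have gTL : `|g^T| <= L by exact: le_trans (mx_norm_tr g) gL.
set X := f0 - 2 *: f1 + f2 in B2 *; set Y := f2 - f1 in B1 *.
have mulL (A B : 'M[R]_d) a b : `|A| <= a -> `|B| <= b -> `|A *m B| <= d%:R * a * b.
  move=> Aa Bb; apply: le_trans (mx_norm_mul A B) _.
  by rewrite -!mulrA ler_wpM2l // ler_pM.
have C1 := mulL _ _ _ _ gL B2; have C2 := mulL _ _ _ _ B2 gTL.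
have C3 := mulL _ _ _ _ (mulL _ _ _ _ gL B1) gTL.
set Q := _ + _ - _ + f2 in B3 *.
have T1 : `|(2 * h) *: (g *m X + X *m g^T)| <= 2 * h * (4 * d%:R * L * M * h ^+ 2).
  rewrite normrZ (ger0_norm (ltW h2)) ler_wpM2l ?(ltW h2) //.
  apply: le_trans (ler_normD _ _) _; apply: le_trans (lerD C1 C2) _.
  by rewrite le_eqVlt; apply/orP; left; apply/eqP; ring.
have T2 : `|(4 * h ^+ 2) *: (g *m Y *m g^T)| <=
    4 * h ^+ 2 * ((d%:R * L) ^+ 2 * M * h).
  have h4 : 0 <= 4 * h ^+ 2 by rewrite mulr_ge0 // sqr_ge0.
  rewrite normrZ (ger0_norm h4) ler_wpM2l //.
  apply: le_trans C3 _.
  by rewrite le_eqVlt; apply/orP; left; apply/eqP; ring.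
apply: le_trans (ler_normD _ _) _; apply: le_trans (lerD (ler_normD _ _) T2) _.
apply: le_trans (lerD (lerD B3 T1) (lexx _)) _.
by rewrite le_eqVlt; apply/orP; left; apply/eqP; ring.
Qed.

Theorem corollary1 (R : realType) (d : nat) (Omega : set 'cV[R]_d) (T : R)
    (hd : (1 <= d <= 3)%N) (hOmega : bounded_domain Omega) (hT : 0 < T) :
  exists m : nat,
  forall (u : 'cV[R]_d * R -> 'cV[R]_d) (zeta : 'cV[R]_d * R -> 'M[R]_d),
    C_upto_boundary Omega T m u ->
    (forall (x : 'cV[R]_d) (t : R),
        boundary Omega x -> 0 <= t <= T -> u (x, t) = 0) ->
    C_upto_boundary Omega T m zeta ->
    exists C : R, 0 < C /\
      forall (dt : R) (x : 'cV[R]_d) (n : nat),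
        0 < dt ->
        (dt%:E * C0W1inf_norm Omega T u <= (8^-1)%:E)%E ->
        closure Omega x ->
        (2 <= n)%N -> n%:Z <= Num.floor (T / dt) ->
        frobenius (upper_convected Omega T u zeta (x, tn dt n)
                   - bdf2_upper_convected Omega T u zeta dt n x)
          <= C * dt ^+ 2.
Proof.
case: hOmega => oO _ _ bO; case/andP: hd => _ d3.
(* Third derivatives of [zeta] control the third-order difference. *)
exists 3%N => u zeta Cu3 u0 Cz.
have Cu : C_upto_boundary Omega T 1 u by exact: C_upto_boundary_le Cu3.
have [K K0 zK] := C_upto_boundary_bounded bO Cz.
have [L L0 gL] := grad_bounded bO hT Cu.
have [U U0 uU] : exists2 U : R, 0 <= U &
    forall p, closed_cylinder Omega T p -> `|u p| <= U.
  by case: Cu => cu _ _; exact: compact_within_bounded (closed_cylinder_compact bO) cu.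
(* [V] bounds the sum of the absolute components of the direction [(- u, -1)]: 1 for time and [d U]
   for space. *)
pose V : R := 1 + d%:R * U.
have V1 : 1 <= V by rewrite lerDl mulr_ge0.
have uV q : closed_cylinder Omega T q -> \sum_i `|dir_coord (- u q, -1) i| <= V.
  move=> /uU qU; rewrite sum_option /= normrN1 lerD2l.
  apply: (@le_trans _ _ (\sum_(j < d) U)).
    apply: ler_sum => j _; rewrite mxE normrN.
    exact: le_trans (entry_ler_norm _ _ _) qU.
  by rewrite sumr_const card_ord -[leLHS]mulr_natl.
pose M := V ^+ 3 * K.
have M0 : 0 <= M by rewrite mulr_ge0 // exprn_ge0 // (le_trans ler01).
pose C := d%:R * M * (6 + 4 * d%:R * L + 2 * (d%:R * L) ^+ 2).
have C0 : 0 <= C.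
  by rewrite !mulr_ge0 // !addr_ge0 // !mulr_ge0 // sqr_ge0.
(* [C] may vanish, whereas the constant has to be positive. *)
exists (C + 1); split=> [|dt x n dt0 hN Ox n2 nT]; first exact: ltr_wpDl.
apply: (@le_trans _ _ (C * dt ^+ 2)); last first.
  by rewrite ler_wpM2r ?sqr_ge0 // lerDl.
pose t := tn dt n.
(* From [2 <= n] and the floor bound on [n], all three time levels lie in [[0, T]]. *)
have tT : 2 * dt <= t <= T.
  rewrite /t /tn ler_pM2r // (ler_nat R 2 n) n2 /=.
  by rewrite -ler_pdivlMr // -[n%:R]/(n%:Z%:~R) -Num.Theory.floor_ge_int.
have cp : closed_cylinder Omega T (x, t).
  by split=> //=; rewrite in_itv /=; case/andP: tT => ? ->; rewrite andbT; lra.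
have [|B1 B2 B3] := @characteristic_differences_closure _ _ _ _ Omega T u zeta K V
  dt t x d3 oO bO hT Cu u0 Cz zK uV V1 dt0 _ Ox tT.
  by move=> y s i j Oy sT; exact: grad_bound oO hT Cu dt0 hN sT Oy.
have tnB k : (k <= n)%N -> tn dt (n - k)%N = t - k%:R * dt.
  by move=> kn; rewrite /t /tn natrB // mulrBl.
(* The evaluation points of the scheme are those of the line from [(x, t)] in direction [(- u, -1)]
   at parameters [dt] and [2 dt]; truncated subtraction is exact here as [2 <= n]. *)
have P1 : (X1 u dt n x, tn dt (n - 1)%N) = (x, t) + dt *: (- u (x, t), -1).
  rewrite tnB; last exact: ltnW.
  by apply: injective_projections; rewrite /= scalerN // [_%:A]mulr1 mul1r.
have P2 : (X1t u dt n x, tn dt (n - 2)%N) = (x, t) + (2 * dt) *: (- u (x, t), -1).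
  by rewrite tnB //; apply: injective_projections; rewrite /= scalerN // [_%:A]mulr1.
(* The material derivative is minus the derivative in the backward direction [(- u, -1)]. *)
have -> : upper_convected Omega T u zeta (x, t) =
    - (\sum_i dir_coord (- u (x, t), -1) i *: partial Omega T i zeta (x, t))
    - grad Omega T u (x, t) *m zeta (x, t) - zeta (x, t) *m (grad Omega T u (x, t))^T.
  rewrite /upper_convected sum_option opprD scaleN1r opprK -sumrN.
  congr (_ + _ - _ - _); apply: eq_bigr => j _ /=.
  by rewrite mxE scaleNr opprK.
rewrite /bdf2_upper_convected P1 P2 /L1 /L1t -/t.
exact: bdf2_error_bound (gL _ cp) B1 B2 B3.
Qed.
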